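(* For $\mu=(\mu_1,\dots,\mu_k)\in\mathcal{M}_+^1(\mathbb{R}^{\mathbb{N}})^k$ put $$\widetilde{\mathcal{R}}(\mu)=2\sigma^2\,\mathbb{P}_X\bigl[\min_{1\le j\le k}\mathcal{K}(\mu_j,\mathbb{P}_{Y\mid X})\bigr].$$ Then $\mathcal{R}(c)=\widetilde{\mathcal{R}}(\mu^{(c)})$ for all $c\in H^k$, and the minimum of $\widetilde{\mathcal{R}}$ coincides with the minimum of $\mathcal{R}$ in the sense that $$\inf_{c\in H^k}\mathcal{R}(c)=\inf_{c\in H^k}\widetilde{\mathcal{R}}(\mu^{(c)})=\inf_{\mu\in\mathcal{M}_+^1(\mathbb{R}^{\mathbb{N}})^k}\widetilde{\mathcal{R}}(\mu).$$
   Context: $H$ is a separable Hilbert space with orthonormal basis $(e_i)_{i\in\mathbb{N}}$, $\sigma>0$, and $X$ is a random variable in $H$ with law $\mathbb{P}_X$. $Y$ is a random variable in $\mathbb{R}^{\mathbb{N}}$ whose conditional law given $X$ is $\mathbb{P}_{Y\mid X}=\bigotimes_{i\in\mathbb{N}}\mathcal{N}(\langle X,e_i\rangle,\sigma^2)$. For $c=(c_1,\dots,c_k)\in H^k$, $\mathcal{R}(c)=\mathbb{P}_X\bigl(\min_{1\le j\le k}\lVert X-c_j\rVert^2\bigr)$ and $\mu^{(c)}=(\mu^{(c)}_1,\dots,\mu^{(c)}_k)$ with $\mu^{(c)}_j=\bigotimes_{i\in\mathbb{N}}\mathcal{N}(\langle c_j,e_i\rangle,\sigma^2)$. $\mathcal{M}_+^1(\mathbb{R}^{\mathbb{N}})$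 is the set of probability measures on $\mathbb{R}^{\mathbb{N}}$. $\mathcal{K}(Q,P)=Q[\log(dQ/dP)]$ if $Q\ll P$, $+\infty$ otherwise, is the Kullback divergence. $\mathbb{P}_X(f(X))$ denotes expectation under $\mathbb{P}_X$. *)

(* Defs.v *)
From HB Require Import structures.
From mathcomp Require Import all_boot all_order all_algebra.
From mathcomp Require Import all_classical all_reals all_analysis.
From mathcomp Require Import measurable_realfun sesquilinear.

Set Implicit Arguments.
Unset Strict Implicit.
Unset Printing Implicit Defensive.

Import Order.TTheory GRing.Theory Num.Theory.
Import numFieldNormedType.Exports.

Local Open Scope classical_set_scope.
Local Open Scope ring_scope.
Local Open Scope ereal_scope.
Local Open Scope charge_scope.

Section HilbertSpace.
Context (R : realType) (H : completeNormedModType R).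

(* For a complete [H], this makes [ip] a Hilbert space structure: bilinearity,
   symmetry and definiteness are part of the type of [ip]. *)
Definition induces_norm (ip : {dot H for (idfun : R -> R)}) : Prop :=
  forall x : H, (`|x| ^+ 2 = ip x x)%R.

(* Indexing by [nat] makes [H] separable and infinite-dimensional. *)
Definition orthonormal_basis (ip : {dot H for (idfun : R -> R)})
    (e : nat -> H) : Prop :=
  (forall i j, ip (e i) (e j) = (i == j)%:R%R) /\
  (forall x : H, series (fun i => ip x (e i) *: e i)%R @ \oo --> x).

Definition borel : measurableType _ := g_sigma_algebraType (@open H).

End HilbertSpace.

Section RealSequences.
Context (R : realType).

Definition coordinate_preimages : set (set (nat -> R)) :=
  [set C | exists i, exists2 A : set R,
    measurable A & C = [set y : nat -> R | A (y i)]].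

Definition RN : measurableType _ := g_sigma_algebraType coordinate_preimages.

(* By the pi-lambda theorem, these values on cylinders determine [Q] on all
   measurable sets. *)
Definition is_product_law (P : nat -> probability (measurableTypeR R) R)
    (Q : probability RN R) : Prop :=
  forall (n : nat) (A : nat -> set R), (forall i, measurable (A i)) ->
    Q [set y : nat -> R | forall i, (i < n)%N -> A i (y i)] =
    \prod_(i < n) P i (A i).

(* The library has no infinite product of measures. Such a product always
   exists, so the default value [point] of [xget] is never used, and it is
   unique on measurable sets, which is all that integrals and densities see. *)
Definition product_prob (P : nat -> probability (measurableTypeR R) R) :
    probability RN R :=
  xget point [set Q | is_product_law P Q].

End RealSequences.

(* Regular conditional law [kappa] of [Y] given [X]. *)
Definition is_conditional_law (R : realType) d dS dT
    (Omega : measurableType d) (S : measurableType dS) (T : measurableType dT)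
    (P : probability Omega R) (X : {RV P >-> S}) (Y : {RV P >-> T})
    (kappa : S -> probability T R) : Prop :=
  (forall B, measurable B -> measurable_fun [set: S] (fun x => kappa x B : \bar R)) /\
  (forall A B, measurable A -> measurable B ->
    P (X @^-1` A `&` Y @^-1` B) = \int[distribution P X]_(x in A) kappa x B).

(* The negative part of the integrand is [Q]-integrable, so this integral is
   well defined in ]-oo, +oo]; [lne 0 = -oo] only matters on a [Q]-null set. *)
Definition kullback (R : realType) d (T : measurableType d)
    (Q P : probability T R) : \bar R :=
  if `[< Q `<< P >]
  then \int[Q]_y lne (('d (charge_of_finite_measure Q) '/d P) y)
  else +oo.

Section Risks.
Context (R : realType) (H : completeNormedModType R).

Definition gaussian_shift (ip : {dot H for (idfun : R -> R)}) (e : nat -> H)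
    (sigma : R) (x : H) : nat -> probability (measurableTypeR R) R :=
  fun i => normal_prob (ip x (e i)) sigma.

(* Minima over ['I_k], [0 < k], are written as big operators starting at
   [+oo], the neutral element of [mine]. *)
Definition risk (PX : probability (borel H) R) (k : nat) (c : 'I_k -> H) :
    \bar R :=
  \int[PX]_x \big[mine/+oo]_(j < k) (`|(x : H) - c j| ^+ 2)%R%:E.

Definition kullback_risk (sigma : R) (PX : probability (borel H) R)
    (kappa : borel H -> probability (RN R) R) (k : nat)
    (mu : 'I_k -> probability (RN R) R) : \bar R :=
  (2 * sigma ^+ 2)%R%:E *
  \int[PX]_x \big[mine/+oo]_(j < k) kullback (mu j) (kappa x).

Definition gaussian_codebook (ip : {dot H for (idfun : R -> R)})
    (e : nat -> H) (sigma : R) (k : nat) (c : 'I_k -> H) :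
    'I_k -> probability (RN R) R :=
  fun j => product_prob (gaussian_shift ip e sigma (c j)).

End Risks.

(* Main.v *)
Require Import Defs.
From HB Require Import structures.
From mathcomp Require Import all_boot all_order all_algebra.
From mathcomp Require Import all_classical all_reals all_analysis.
From mathcomp Require Import measurable_realfun sesquilinear.
From mathcomp Require Import ring lra.
Set Implicit Arguments.
Unset Strict Implicit.
Unset Printing Implicit Defensive.
Import Order.TTheory GRing.Theory Num.Theory.
Import numFieldNormedType.Exports.
Local Open Scope classical_set_scope.
Local Open Scope ring_scope.

(** Everything rests on the formula, for Gaussian product laws of common
    variance sigma^2 and means m, m' whose difference is square-summable,

      K (N(m'), N(m)) = |m' - m|^2 / (2 sigma^2),

    which turns each divergence in the second risk, at a codebook c, into the
    squared distance of the first (almost surely in x), and on the inequality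

      K (Q, N(m)) >= |mean Q - m|^2 / (2 sigma^2)

    for an arbitrary law Q, which says that replacing each law of a codebook
    by the Gaussian one with the same mean never increases the risk.  If
    K (Q, N(m)) is finite for one admissible m, the mean of Q differs from m
    by a square-summable sequence, so it is the coordinate sequence of a point
    of H; if it is infinite for all of them, any point of H will do.

    Lower bound ([integral_le_kullback], [kullback_ge_mean]): if f = dQ/dP and
    the exponential of phi has P-integral at most 1, then
    ln f >= phi + 1 - exp phi / f, and integrating against Q gives
    K (Q, P) >= Q phi; the optimal affine function phi of the first n
    coordinates yields the partial sums of the right-hand side.

    Upper bound ([cameron_martin], [kullback_product_law_le]): reweighting
    finitely many coordinates of N(m) by exponentials moves the corresponding
    means.  These finite densities are Cauchy in mean square as soon as the
    shift is square-summable; along a subsequence they converge almost surely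
    to a density Z of the fully shifted law.  This also provides every
    Gaussian product law with mean in H, starting from the one that the
    conditional law supplies.  Finally l ln Z <= Z^l - 1, Fatou's lemma
    and an exponential moment bound the divergence; l tends to 0.

    The map from x to K (mu_j, P_{Y|X=x}) need not be known to be measurable.
    Its integral is then a lower integral, and the comparison with the integral
    of a squared distance only uses that lower integrals are monotone up to
    null sets ([ae_ge0_le_lower_integral]). *)

(** * Integrals without measurability, and densities *)

Section lower_integral.
Import HBNNSimple.

(** The integral of a nonnegative function is a supremum over the simple
    functions below it, so it is monotone even off the measurable functions;
    multiplying a simple function by the indicator of a set of full measure
    takes care of the null set. *)
Lemma ae_ge0_le_lower_integral (R : realType) d (T : measurableType d)
    (mu : {measure set T -> \bar R}) (f g : T -> \bar R) :
  (forall x, 0 <= f x)%E -> (forall x, 0 <= g x)%E ->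
  {ae mu, forall x, (f x <= g x)%E} ->
  (\int[mu]_x f x <= \int[mu]_x g x)%E.
Proof.
move=> f0 g0 [N [mN muN fgN]].
rewrite !ge0_integralTE//; apply: ge_ereal_sup => _ [h hf <-].
have mNC := measurableC mN.
apply: ereal_sup_ubound; exists (mul_nnsfun h (indic_nnsfun R mNC)).
  move=> x /=; rewrite mindicE; case: (boolP (x \in ~` N)) => xN.
    rewrite mulr1; apply: le_trans (hf x) _.
    by move: xN; rewrite inE; apply: contra_notP => ?; exact: fgN.
  by rewrite mulr0.
rewrite -!integralT_nnsfun.
rewrite [RHS](ge0_negligible_integral mN) //; last 2 first.
- exact/measurable_EFinP.
- by move=> x _; rewrite lee_fin.
rewrite [LHS](ge0_negligible_integral mN) //; last 2 first.
- by apply/measurable_EFinP.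
- by move=> x _; rewrite lee_fin.
apply: eq_integral => x; rewrite inE => -[_ xN] /=.
by rewrite mindicE mem_set// mulr1.
Qed.

Lemma ae_eq_ge0_lower_integral (R : realType) d (T : measurableType d)
    (mu : {measure set T -> \bar R}) (f g : T -> \bar R) :
  (forall x, 0 <= g x)%E -> {ae mu, forall x, f x = g x} ->
  (\int[mu]_x f x = \int[mu]_x g x)%E.
Proof.
move=> g0 fg; rewrite integralE.
have -> : (\int[mu]_x f^\- x = 0)%E.
  apply/le_anti/andP; split; last exact: integral_ge0.
  rewrite -[leRHS](integral0 mu setT).
  apply: ae_ge0_le_lower_integral => //.
  by apply: filterS fg => x; rewrite funenegE => ->; rewrite ge_max lexx oppe_le0 g0.
rewrite sube0; apply/le_anti/andP; split; apply: ae_ge0_le_lower_integral => //;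
  apply: filterS fg => x; rewrite funeposE => ->.
  by rewrite ge_max lexx g0.
by rewrite le_max lexx.
Qed.

(** The positive and negative parts are compared separately. *)
Lemma le_integral_minorant (R : realType) d (T : measurableType d)
    (mu : {measure set T -> \bar R}) (f g : T -> \bar R) :
  {ae mu, forall x, (g x <= f x)%E} ->
  (\int[mu]_x g x <= \int[mu]_x f x)%E.
Proof.
move=> gf; rewrite integralE [leRHS]integralE.
apply: leeB; apply: ae_ge0_le_lower_integral => //; apply: filterS gf => x gfx.
  by rewrite !funeposE ge_max !le_max lexx gfx orbT.
by rewrite !funenegE ge_max !le_max lexx leeN2 gfx orbT.
Qed.

End lower_integral.

(** By uniqueness of the derivative, [f] is almost everywhere the
    Radon-Nikodym derivative, for which the change of variables is known. *)
Lemma integral_density (R : realType) d (T : measurableType d)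
    (mu : {sigma_finite_measure set T -> \bar R})
    (nu : {finite_measure set T -> \bar R}) (f g : T -> \bar R) :
  mu.-integrable setT f ->
  (forall A, measurable A -> nu A = \int[mu]_(x in A) f x)%E ->
  (forall x, 0 <= f x)%E ->
  (forall x, 0 <= g x)%E -> measurable_fun setT g ->
  (\int[nu]_x g x = \int[mu]_x (g x * f x))%E.
Proof.
move=> intf nuE f0 g0 mg.
have numu : nu `<< mu.
  apply/null_content_dominatesP => A mA muA; rewrite nuE//.
  by rewrite null_set_integral//; apply: measurable_funTS; case/integrableP: intf.
rewrite -(Radon_Nikodym_SigmaFinite.change_of_variables numu)//.
set r := Radon_Nikodym_SigmaFinite.f nu mu.
have r0 := Radon_Nikodym_SigmaFinite.f_ge0 numu.
have mr := measurable_int _ (Radon_Nikodym_SigmaFinite.f_integrable numu).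
have mf := measurable_int _ intf.
apply: ge0_ae_eq_integral => //; try by move=> x _; exact: mule_ge0.
- exact: emeasurable_funM.
- exact: emeasurable_funM.
- apply: ae_eqe_mul2l; apply: integral_ae_eq => //.
    exact: Radon_Nikodym_SigmaFinite.f_integrable.
  by move=> A _ mA; rewrite -Radon_Nikodym_SigmaFinite.f_integral// nuE.
Qed.

Lemma density_probability (R : realType) d (T : measurableType d)
    (mu : {measure set T -> \bar R}) (f : T -> \bar R) :
  measurable_fun setT f -> (forall x, 0 <= f x)%E -> (\int[mu]_x f x = 1)%E ->
  exists Q : probability T R,
    forall A, measurable A -> (Q A = \int[mu]_(x in A) f x)%E.
Proof.
move=> mf f0 f1.
pose q (A : set T) := (\int[mu]_(x in A) f x)%E.
have q0 : q set0 = 0%E by rewrite /q integral_set0.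
have qge0 A : (0 <= q A)%E by apply: integral_ge0 => x _.
have qs : semi_sigma_additive q.
  move=> A mA tA mUA; rewrite /q ge0_integral_bigcup//; last first.
    exact: measurable_funTS.
  by apply: is_cvg_ereal_nneg_natsum_cond => n _ _; exact: integral_ge0.
pose H1 := isMeasure.Build _ _ _ q q0 qge0 qs.
pose qm : {measure set T -> \bar R} := HB.pack q H1.
pose H2 := Measure_isProbability.Build _ _ _ qm f1.
pose qp : probability T R := HB.pack (Measure.sort qm) H2.
by exists qp.
Qed.

(** * Sequences that are Cauchy in mean *)

Section summable_increments.
Context (R : realType) d (T : measurableType d) (mu : {measure set T -> \bar R}).
Variable f : nat -> T -> R.
Hypothesis mf : forall n, measurable_fun setT (f n).
Hypothesis f0_fin : (\int[mu]_x (`|f 0%N x|)%:E < +oo)%E.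
Hypothesis f_sum : (\sum_(0 <= k <oo) \int[mu]_x (`|f k.+1 x - f k x|)%:E < +oo)%E.

(** The sum of [`|f 0|] and of the absolute increments is integrable, hence
    almost everywhere finite, and it dominates the whole sequence. *)
Lemma summable_increments_cvg : exists F : T -> \bar R,
  [/\ measurable_fun setT F,
      {ae mu, forall x, (f n x)%:E @[n --> \oo] --> F x} &
      forall A, measurable A ->
        (\int[mu]_(x in A) (f n x)%:E)%E @[n --> \oo] --> (\int[mu]_(x in A) F x)%E].
Proof.
pose D k x := (`|f k.+1 x - f k x|)%:E.
pose g x := ((`|f 0%N x|)%:E + \sum_(0 <= k <oo) D k x)%E.
have mD k : measurable_fun setT (D k).
  by apply/measurable_EFinP/measurableT_comp => //; exact: measurable_funB.
have mS : measurable_fun setT (fun x => \sum_(0 <= k <oo) D k x)%E.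
  by apply: ge0_emeasurable_sum => // k x _ _; rewrite lee_fin.
have S0 x : (0 <= \sum_(0 <= k <oo) D k x)%E by apply: nneseries_ge0 => k _ _; rewrite lee_fin.
have mf0 : measurable_fun setT (fun x => (`|f 0%N x|)%:E).
  by apply/measurable_EFinP/measurableT_comp.
have mg : measurable_fun setT g by exact: emeasurable_funD.
have ig : mu.-integrable setT g.
  apply/integrableP; split => //.
  under eq_integral => x _ do rewrite gee0_abs ?adde_ge0 ?lee_fin//.
  rewrite ge0_integralD//= integral_nneseries//; last first.
    by move=> n x _; rewrite lee_fin.
  exact: lte_add_pinfty.
have partial n x : ((`|f 0%N x| + \sum_(0 <= k < n) `|f k.+1 x - f k x|)%:E <= g x)%E.
  rewrite EFinD leeD2l// -sumEFin.
  by apply: nneseries_lim_ge => k _ _; rewrite lee_fin.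
have fg n x : (`|(f n x)%:E| <= g x)%E.
  apply: le_trans (partial n x); rewrite abse_EFin lee_fin.
  elim: n => [|n ih]; first by rewrite big_geq// addr0.
  rewrite big_nat_recr//= addrA.
  rewrite -[in leLHS](addrNK (f n x) (f n.+1 x)).
  by apply: (le_trans (ler_normD _ _)); rewrite [leLHS]addrC lerD2r.
pose F x := limn_esup (fun n => (f n x)%:E).
have fF : {ae mu, forall x, (f n x)%:E @[n --> \oo] --> F x}.
  apply: filterS (integrable_ae measurableT ig) => x /(_ I) gfin.
  have cvf : cvgn (f^~ x).
    rewrite (_ : f^~ x = fun n => f 0%N x + series (telescope (f^~ x)) n); last first.
      by apply/funext => n; rewrite -eq_sum_telescope.
    apply: is_cvgD; first exact: is_cvg_cst.
    apply: normed_cvg; apply: nondecreasing_is_cvgn.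
      by apply: nondecreasing_series => k _ _; exact: normr_ge0.
    exists (fine (g x)) => _ [n _ <-].
    rewrite -lee_fin fineK//; apply: le_trans (partial n x).
    by rewrite lee_fin /series/= ler_wpDl.
  have ecvf : cvgn (fun n => (f n x)%:E).
    apply/cvg_ex; exists (limn (f^~ x))%:E; apply/fine_cvgP; split => //.
    exact: nearW.
  by rewrite /F is_cvg_limn_esupE.
have mF : measurable_fun setT F.
  by apply: measurable_fun_limn_esup => n; apply/measurable_EFinP.
exists F; split => // A mA.
have [|||||_ _ //] := @dominated_convergence _ _ _ mu A mA (fun n x => (f n x)%:E) F g.
- by move=> n; apply: measurable_funTS; exact/measurable_EFinP.
- exact: measurable_funTS.
- by apply: filterS fF.
- exact: integrableS ig.
- by apply: aeW.
Qed.

End summable_increments.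

(** Completeness of L^1, in the form used below: a subsequence with
    geometrically small increments is dominated and converges almost everywhere. *)
Lemma L1_cauchy_subseq (R : realType) d (T : measurableType d)
    (mu : {measure set T -> \bar R}) (f : nat -> T -> R) :
  (forall n, measurable_fun setT (f n)) ->
  (forall n, (\int[mu]_x (`|f n x|)%:E < +oo)%E) ->
  (forall e : R, 0 < e -> exists N, forall n p, (N <= n)%N -> (n <= p)%N ->
    (\int[mu]_x (`|f p x - f n x|)%:E <= e%:E)%E) ->
  exists (phi : nat -> nat) (F : T -> \bar R),
  [/\ forall k, (k <= phi k)%N, measurable_fun setT F,
      {ae mu, forall x, (f (phi k) x)%:E @[k --> \oo] --> F x} &
      forall A, measurable A ->
        (\int[mu]_(x in A) (f (phi k) x)%:E)%E @[k --> \oo] --> (\int[mu]_(x in A) F x)%E].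
Proof.
move=> mf ffin fC.
pose e k : R := 1 / (2 ^ k.+1)%:R.
have e_gt0 k : 0 < e k by rewrite divr_gt0// ltr0n expn_gt0.
have [N NP] := choice (fun k => fC _ (e_gt0 k)).
pose phi := fix phi k := if k is k'.+1 then maxn (phi k').+1 (N k'.+1) else N 0%N.
have phiN k : (N k <= phi k)%N by case: k => //= k; exact: leq_maxr.
have phiS k : (phi k < phi k.+1)%N by rewrite /= leq_maxl.
have phik k : (k <= phi k)%N.
  by elim: k => // k ih; exact: leq_ltn_trans ih (phiS k).
have [|||F [mF fF intF]] := @summable_increments_cvg _ _ _ mu (fun k => f (phi k)).
- by move=> k; exact: mf.
- exact: ffin.
- apply: (@le_lt_trans _ _ 1%:E%E); last exact: ltry.
  apply: (le_trans _ (epsilon_trick0 xpredT (@ler01 R))).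
  apply: lee_nneseries => k _; first by move=> _; apply: integral_ge0 => x _; rewrite lee_fin.
  by apply: NP => //; exact: ltnW.
by exists phi, F.
Qed.

(** * Product laws on sequences *)

Section product_law.
Context (R : realType).
Implicit Types (P : nat -> probability (measurableTypeR R) R).
Implicit Types (Q : probability (RN R) R) (A : nat -> set R).

Definition coordinate (i : nat) (y : RN R) : measurableTypeR R := y i.

Lemma measurable_coordinate i : measurable_fun [set: RN R] (coordinate i).
Proof.
move=> _ B mB; rewrite setTI; apply: sub_sigma_algebra.
by exists i, B.
Qed.

Definition cylinder (n : nat) A : set (RN R) :=
  [set y : RN R | forall i, (i < n)%N -> A i (y i)].

Lemma measurable_cylinder n A : (forall i, measurable (A i)) ->
  measurable (cylinder n A).
Proof.
move=> mA; have -> : cylinder n A = \bigcap_(i in `I_n) coordinate i @^-1` A i by [].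
apply: fin_bigcap_measurable; first exact: finite_II.
move=> i _; have := measurable_coordinate i measurableT (mA i); rewrite setTI; exact.
Qed.

Lemma cylinder_widen n m A : (n <= m)%N ->
  cylinder n A = cylinder m (fun i => if (i < n)%N then A i else setT).
Proof.
move=> nm; apply/seteqP; split => y /= yA i im.
  by case: ifPn => // /yA.
by have := yA i (leq_trans im nm); rewrite im.
Qed.

Lemma prod_widen P n m A : (n <= m)%N ->
  (\prod_(i < m) P i (if (i < n)%N then A i else setT) =
   \prod_(i < n) P i (A i))%E.
Proof.
move=> nm; rewrite -(big_mkord xpredT (fun i => P i (if (i < n)%N then A i else setT))).
rewrite (big_cat_nat (leq0n n) nm)//= [X in (_ * X)%E](_ : _ = 1%E).
  by rewrite mule1 big_mkord; apply: eq_bigr => i _; rewrite ltn_ord.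
rewrite big_nat_cond big1// => i /andP[/andP[ni _] _].
by rewrite ltnNge ni probability_setT.
Qed.

(** Padding a cylinder with full sets changes neither side of the product
    formula; this allows any given coordinate to be assumed constrained. *)
Lemma is_product_law_wide P Q j :
  (forall n A, (j < n)%N -> (forall i, measurable (A i)) ->
    Q (cylinder n A) = \prod_(i < n) P i (A i))%E -> is_product_law P Q.
Proof.
move=> wide n A mA.
have nm : (n <= maxn n j.+1)%N by exact: leq_maxl.
rewrite -/(cylinder n A) (cylinder_widen A nm) wide ?leq_maxr//.
  exact: prod_widen.
by move=> i; case: ifP.
Qed.

(** Cylinders are stable under intersection and generate the sigma-algebra. *)
Lemma product_law_unique P Q Q' : is_product_law P Q -> is_product_law P Q' ->
  forall B, measurable B -> Q B = Q' B.
Proof.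
move=> QP Q'P.
pose G : set (set (RN R)) := [set C | exists n A, (forall i, measurable (A i)) /\ C = cylinder n A].
have mG : G `<=` measurable by move=> _ [n [A [mA ->]]]; exact: measurable_cylinder.
have sG B : measurable B -> <<s G >> B.
  apply: smallest_sub; first exact: smallest_sigma_algebra.
  move=> _ [i [C mC ->]]; apply: sub_sigma_algebra.
  exists i.+1, (fun j => if j == i then C else setT); split.
    by move=> j; case: ifP.
  apply/seteqP; split => y /= yC.
    by move=> j _; case: eqP => // ->.
  by have := yC i (ltnSn i); rewrite eqxx.
move=> B mB; apply: (g_sigma_algebra_measure_unique G mG (fun=> setT)); last exact: sG.
- by move=> _; exists 0%N, (fun=> setT); split => //; apply/seteqP; split.
- by rewrite bigcup_const//; exists 0%N.
- move=> _ _ [n [A [mA ->]]] [m [C [mC ->]]].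
  exists (maxn n m), (fun i => (if (i < n)%N then A i else setT) `&`
    (if (i < m)%N then C i else setT)); split.
    by move=> i; apply: measurableI; case: ifP.
  rewrite (cylinder_widen A (leq_maxl n m)) (cylinder_widen C (leq_maxr n m)).
  by apply/seteqP; split => y /=; [move=> [yA yC] i im; split; [exact: yA|exact: yC]
    |move=> yAC; split=> i /yAC []].
- by move=> _ [n [A [mA ->]]]; rewrite [LHS]QP// [RHS]Q'P.
- by move=> _; rewrite (le_lt_trans (probability_le1 _ measurableT))// ltry.
Qed.

(** On the event that the other coordinates lie in given sets, the law of
    coordinate [j] is a multiple of its marginal; integrating the weight [f]
    against that multiple factors the product formula. *)
Lemma product_law_reweight P P' Q Q' (j : nat) (f : R -> \bar R) :
  is_product_law P Q ->
  measurable_fun [set: measurableTypeR R] f -> (forall t, 0 <= f t)%E ->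
  (forall i (B : set R), i != j -> P' i B = P i B) ->
  (forall B, measurable B -> P' j B = \int[P j]_(t in B) f t)%E ->
  (forall B, measurable B -> Q' B = \int[Q]_(y in B) f (coordinate j y))%E ->
  is_product_law P' Q'.
Proof.
move=> QP mf f0 P'P P'j Q'E; apply: (@is_product_law_wide _ _ j) => n A jn mA.
pose C := cylinder n (fun i => if i == j then setT else A i).
have mC : measurable C by apply: measurable_cylinder => i; case: ifP.
have CE : cylinder n A = (coordinate j @^-1` A j) `&` C.
  apply/seteqP; split => y /=.
    by move=> yA; split; [exact: yA|move=> i /yA; case: eqP => // ->].
  move=> [yj yC] i ilt; have [->//|ij] := eqVneq i j.
  by have := yC i ilt; rewrite (negbTE ij).
pose jn' := Ordinal jn.
pose c := fine (\prod_(i < n | i != jn') P i (A i))%E.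
have cfin : (\prod_(i < n | i != jn') P i (A i))%E \is a fin_num.
  by elim/big_ind : _ => [//|x y xf yf|i _]; [exact: fin_numM|exact: (fin_num_measure (P i) (A i) (mA i))].
have c0 : 0 <= c by apply: fine_ge0; apply: prode_ge0 => i _.
have nuE B : measurable B ->
    (mrestr Q mC (coordinate j @^-1` B) = c%:E * P j B)%E.
  move=> mB; rewrite /mrestr.
  have -> : coordinate j @^-1` B `&` C = cylinder n (fun i => if i == j then B else A i).
    apply/seteqP; split => y /=.
      by move=> [yB yC] i /yC; case: eqP => // ->.
    move=> yB; split; first by have := yB j jn; rewrite eqxx.
    by move=> i /yB; case: eqP.
  rewrite [LHS]QP; last by move=> i; case: ifP.
  rewrite (bigD1 jn')//= eqxx muleC fineK//; congr (_ * _)%E.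
  by apply: eq_bigr => i ij; rewrite ifN.
pose h := (f \_ (A j)).
have mh : measurable_fun [set: measurableTypeR R] h.
  by apply/(measurable_restrictT f (mA j)); exact: measurable_funTS.
have h0 t : (0 <= h t)%E by rewrite /h/= patchE; case: ifP.
have mhc : measurable_fun [set: RN R] (fun y => h (coordinate j y)).
  exact: (measurableT_comp mh (measurable_coordinate j)).
rewrite Q'E; last exact: measurable_cylinder.
rewrite integral_mkcond CE.
transitivity (\int[Q]_y (h (coordinate j y) * (\1_C y)%:E))%E.
  apply: eq_integral => y _; rewrite /h !patchE indicE in_setI.
  have -> : (y \in coordinate j @^-1` A j) = (coordinate j y \in A j) by [].
  by case: (coordinate j y \in A j) => /=; [case: (y \in C) => /=; rewrite ?mule1 ?mule0|rewrite mul0e].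
rewrite -(integral_density (nu := mrestr Q mC))//; last first.
- by move=> D mD; rewrite integral_indic// setIC.
- exact: integrable_indic.
transitivity (\int[pushforward (mrestr Q mC) (coordinate j)]_t h t)%E.
  rewrite ge0_integral_pushforward//; exact: measurable_coordinate.
(* Conditioned on [C], coordinate [j] has law [c] times its marginal. *)
transitivity (\int[mscale (NngNum c0) (P j)]_t h t)%E.
  apply: eq_measure_integral => [|mj D mD _]; first exact: measurable_coordinate.
  exact: nuE.
rewrite ge0_integral_mscale//= /h -integral_mkcond -(P'j _ (mA j)).
rewrite (bigD1 jn')//= [RHS]muleC /c fineK//; congr (_ * _)%E.
by apply: eq_bigr => i ij; rewrite P'P.
Qed.

End product_law.

Section product_law_density.
Context (R : realType).
Implicit Types (P : nat -> probability (measurableTypeR R) R).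

Lemma product_law_marginal P (Q : probability (RN R) R) i (f : R -> \bar R) :
  is_product_law P Q ->
  measurable_fun [set: measurableTypeR R] f -> (forall t, 0 <= f t)%E ->
  (\int[Q]_y f (coordinate i y) = \int[P i]_t f t)%E.
Proof.
move=> QP mf f0.
transitivity (\int[pushforward Q (@coordinate R i)]_t f t)%E.
  by rewrite ge0_integral_pushforward//; exact: measurable_coordinate.
apply: eq_measure_integral => [|mi D mD _]; first exact: measurable_coordinate.
have := QP i.+1 (fun j => if j == i then D else setT).
rewrite big_ord_recr/= eqxx big1 ?mul1e; last first.
  by move=> j _; rewrite ltn_eqF// probability_setT.
move=> <-; last by move=> j; case: ifP.
congr (Q _); apply/seteqP; split => y /= yD.
  by move=> j _; case: eqP => // ->.
by have := yD i (ltnSn i); rewrite eqxx.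
Qed.

Lemma product_law_reweight_ex P P' Q (j : nat) (f : R -> \bar R) :
  is_product_law P Q ->
  measurable_fun [set: measurableTypeR R] f -> (forall t, 0 <= f t)%E ->
  (forall i (B : set R), i != j -> P' i B = P i B) ->
  (forall B, measurable B -> P' j B = \int[P j]_(t in B) f t)%E ->
  exists2 Q', is_product_law P' Q' &
    (forall B, measurable B -> Q' B = \int[Q]_(y in B) f (coordinate j y))%E.
Proof.
move=> QP mf f0 P'P P'j.
have mfc : measurable_fun [set: RN R] (fun y => f (coordinate j y)).
  exact: (measurableT_comp mf (@measurable_coordinate R j)).
have f1 : (\int[Q]_y f (coordinate j y) = 1)%E.
  by rewrite (product_law_marginal j QP)// -P'j// probability_setT.
have [Q' Q'E] := density_probability mfc (fun y => f0 _) f1.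
by exists Q' => //; exact: (product_law_reweight QP mf f0 P'P P'j Q'E).
Qed.

End product_law_density.

(** * Gaussian product laws and the Cameron-Martin density *)

Section gaussian_tilt.
Context (R : realType) (s : R) (s0 : s != 0).
Implicit Types (m a t : R).

(** Log-density of the normal law of mean [m + s^2 a] with respect to the one
    of mean [m]. *)
Definition logtilt a m t : R := a * (t - m) - (s * a) ^+ 2 / 2.

Lemma measurable_logtilt a m : measurable_fun [set: measurableTypeR R] (logtilt a m).
Proof.
apply: measurable_funB => //; apply: measurable_funM => //.
exact: measurable_funB.
Qed.

Lemma normal_prob_tilt a m (B : set R) : measurable B ->
  (normal_prob (m + s ^+ 2 * a) s B =
   \int[normal_prob m s]_(t in B) (expR (logtilt a m t))%:E)%E.
Proof.
move=> mB; rewrite integral_mkcond.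
have mh : measurable_fun [set: measurableTypeR R]
    ((fun t => (expR (logtilt a m t))%:E) \_ B).
  apply/(measurable_restrictT _ mB); apply: measurable_funTS.
  by apply/measurable_EFinP; apply: measurableT_comp => //; exact: measurable_logtilt.
rewrite (integral_density (mu := lebesgue_measure) (f := fun t => (normal_pdf m s t)%:E))//.
- rewrite /normal_prob [LHS]integral_mkcond; apply: eq_integral => t _.
  rewrite !patchE; case: ifP => _; last by rewrite mul0e.
  rewrite -EFinM; congr EFin; rewrite !normal_pdfE// /normal_fun mulrCA -expRD.
  congr (_ * expR _); rewrite /logtilt; field.
  by [].
- exact: integrable_normal_pdf.
- by move=> t; rewrite lee_fin normal_pdf_ge0.
- by move=> t; rewrite patchE; case: ifP => // _; rewrite lee_fin expR_ge0.
Qed.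

Context (m a : nat -> R).

(** Log-density of the product law whose first [n] means are shifted. *)
Definition loglik (n : nat) (y : RN R) : R :=
  \sum_(i < n) logtilt (a i) (m i) (coordinate i y).

Lemma measurable_loglik n : measurable_fun [set: RN R] (loglik n).
Proof.
apply: measurable_sum => i.
exact: (measurableT_comp (measurable_logtilt _ _) (@measurable_coordinate R i)).
Qed.

Lemma measurable_lik n : measurable_fun [set: RN R] (fun y => (expR (loglik n y))%:E).
Proof. apply/measurable_EFinP/measurableT_comp => //; exact: measurable_loglik. Qed.

(** Induction on [n], reweighting one more coordinate at each step; densities
    multiply. *)
Lemma product_law_tilt (Q : probability (RN R) R) n :
  is_product_law (fun i => normal_prob (m i) s) Q ->
  exists2 Q' : probability (RN R) R,
    is_product_law (fun i => normal_prob (if (i < n)%N then m i + s ^+ 2 * a i else m i) s) Q' &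
    forall B, measurable B -> (Q' B = \int[Q]_(y in B) (expR (loglik n y))%:E)%E.
Proof.
move=> Qm; elim: n => [|n [Qn Qnm QnE]].
  exists Q => // B mB; under eq_integral do rewrite /loglik big_ord0 expR0.
  by rewrite integral_cst// mul1e.
pose m' i := if (i < n.+1)%N then m i + s ^+ 2 * a i else m i.
have [||||Q' Q'm Q'E] := @product_law_reweight_ex _ _
  (fun i => normal_prob (m' i) s) _ n (fun t => (expR (logtilt (a n) (m n) t))%:E) Qnm.
- by apply/measurable_EFinP/measurableT_comp => //; exact: measurable_logtilt.
- by move=> t; rewrite lee_fin expR_ge0.
- by move=> i B ij; rewrite /m' ltnS leq_eqVlt (negbTE ij).
- by move=> B mB; rewrite ltnn -normal_prob_tilt// /m' ltnSn.
exists Q' => // B mB; rewrite Q'E// integral_mkcond.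
have int_lik : Q.-integrable setT (fun y => (expR (loglik n y))%:E).
  apply/integrableP; split; first exact: measurable_lik.
  under eq_integral do rewrite gee0_abs ?lee_fin ?expR_ge0//.
  by rewrite -QnE// probability_setT ltry.
rewrite (integral_density int_lik QnE)//.
- rewrite [RHS]integral_mkcond; apply: eq_integral => y _.
  rewrite !patchE; case: ifP => _; last by rewrite mul0e.
  by rewrite -EFinM -expRD /loglik big_ord_recr/= addrC.
- by move=> y; rewrite patchE; case: ifP => // _; rewrite lee_fin expR_ge0.
- apply/(measurable_restrictT _ mB); apply: measurable_funTS.
  apply/measurable_EFinP/measurableT_comp => //.
  exact: (measurableT_comp (measurable_logtilt _ _) (@measurable_coordinate R n)).
Qed.

Lemma integral_lik (Q : probability (RN R) R) n :
  is_product_law (fun i => normal_prob (m i) s) Q ->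
  (\int[Q]_y (expR (loglik n y))%:E = 1)%E.
Proof.
by move=> Qm; have [Q' _ <-//] := product_law_tilt n Qm; rewrite probability_setT.
Qed.

End gaussian_tilt.

Section cameron_martin.
Context (R : realType) (s : R) (s0 : s != 0).

Lemma loglikD (m a b : nat -> R) n y :
  loglik s m a n y + loglik s m b n y =
  loglik s m (fun i => a i + b i) n y + \sum_(i < n) s ^+ 2 * (a i * b i).
Proof.
rewrite /loglik -!big_split/=; apply: eq_bigr => i _.
by rewrite /logtilt; field.
Qed.

Lemma loglik_trunc (m a : nat -> R) n p y : (n <= p)%N ->
  loglik s m a n y = loglik s m (fun i => if (i < n)%N then a i else 0) p y.
Proof.
move=> np; rewrite /loglik (big_ord_widen p (fun i => logtilt s (a i) (m i) (coordinate i y)) np).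
rewrite big_mkcond/=; apply: eq_bigr => i _; case: ifP => // _.
by rewrite /logtilt; field.
Qed.

Context (m a : nat -> R) (Q : probability (RN R) R).
Hypothesis Qm : is_product_law (fun i => normal_prob (m i) s) Q.

Let S n : R := \sum_(i < n) (s * a i) ^+ 2.
Let Z n y : R := expR (loglik s m a n y).

Let mZ n : measurable_fun [set: RN R] (Z n).
Proof. by apply/measurable_EFinP; exact: measurable_lik. Qed.

(** The product of two exponential tilts is the tilt by the sum of the shifts,
    up to a constant factor, and a tilt integrates to 1. *)
Lemma integral_lik_mul n p : (n <= p)%N ->
  (\int[Q]_y (Z n y * Z p y)%:E = (expR (S n))%:E)%E.
Proof.
move=> np; pose b i := if (i < n)%N then a i else 0.
have ZE y : Z n y * Z p y = expR (S n) * expR (loglik s m (fun i => b i + a i) p y).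
  rewrite /Z (loglik_trunc _ _ _ np) -expRD loglikD expRD mulrC; congr (expR _ * _).
  rewrite /S (big_ord_widen p (fun i => (s * a i) ^+ 2) np) [RHS]big_mkcond/=.
  by apply: eq_bigr => i _; rewrite /b; case: ifP => _; ring.
under eq_integral do rewrite ZE EFinM.
rewrite ge0_integralZl//.
- by rewrite (integral_lik s0 _ _ Qm) mule1.
- exact: measurable_lik.
Qed.

Lemma integral_lik_sqrB n p : (n <= p)%N ->
  (\int[Q]_y ((Z p y - Z n y) ^+ 2)%:E = (expR (S p) - expR (S n))%:E)%E.
Proof.
move=> np.
have msq : measurable_fun [set: RN R] (fun y => ((Z p y - Z n y) ^+ 2)%:E).
  by apply/measurable_EFinP/measurable_funX/measurable_funB.
have mm i j : measurable_fun [set: RN R] (fun y => (Z i y * Z j y)%:E).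
  by apply/measurable_EFinP/measurable_funM.
have Z0 i j y : (0 <= (Z i y * Z j y)%:E)%E by rewrite lee_fin mulr_ge0 ?expR_ge0.
have : (\int[Q]_y ((Z p y - Z n y) ^+ 2)%:E + (2 * expR (S n))%:E =
        (expR (S p))%:E + (expR (S n))%:E)%E.
  rewrite -[in RHS](integral_lik_mul (leqnn p)) -[in RHS](integral_lik_mul (leqnn n)).
  rewrite EFinM -(integral_lik_mul np) -ge0_integralZl//.
  rewrite -!ge0_integralD//; try by move=> y _; rewrite lee_fin sqr_ge0.
  - by apply: eq_integral => y _; rewrite -!EFinM -!EFinD; congr EFin; ring.
  - by move=> y _; rewrite mule_ge0.
  - by apply: emeasurable_funM => //; exact: mm.
case: (\int[_]_(y in _) _)%E => [r| |]//.
rewrite -!EFinD => -[rE]; congr EFin; lra.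
Qed.

(** The mean square controls the mean through 2 e |t| <= e^2 + t^2, which
    replaces the Cauchy-Schwarz inequality. *)
Lemma integral_lik_dist n p (e : R) : 0 < e -> (n <= p)%N ->
  expR (S p) - expR (S n) <= e ^+ 2 ->
  (\int[Q]_y (`|Z p y - Z n y|)%:E <= e%:E)%E.
Proof.
move=> e0 np Se.
have msq : measurable_fun [set: RN R] (fun y => ((Z p y - Z n y) ^+ 2)%:E).
  by apply/measurable_EFinP/measurable_funX/measurable_funB.
have ie0 : 0 <= (2 * e)^-1 by rewrite invr_ge0 mulr_ge0// ltW.
have e20 : 0 <= e / 2 by rewrite divr_ge0// ltW.
apply: (@le_trans _ _ (\int[Q]_y ((e / 2)%:E + (2 * e)^-1%:E * ((Z p y - Z n y) ^+ 2)%:E))%E).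
  apply: ae_ge0_le_lower_integral => [y|y|].
  - by rewrite lee_fin.
  - by rewrite -EFinM -EFinD lee_fin addr_ge0// mulr_ge0// sqr_ge0.
  - apply: aeW => y; rewrite -EFinM -EFinD lee_fin.
    rewrite -[(Z p y - Z n y) ^+ 2]real_normK ?num_real//.
    set u := `|_|.
    have -> : e / 2 + (2 * e)^-1 * u ^+ 2 = u + (2 * e)^-1 * (u - e) ^+ 2.
      by field; rewrite lt0r_neq0.
    by rewrite lerDl mulr_ge0// sqr_ge0.
have sq0 y : (0 <= ((Z p y - Z n y) ^+ 2)%:E)%E by rewrite lee_fin sqr_ge0.
rewrite ge0_integralD//; last 2 first.
- by move=> y _; rewrite mule_ge0.
- by apply: emeasurable_funM.
rewrite integral_cst// [X in (_ * X)%E](probability_setT Q) mule1 ge0_integralZl//.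
rewrite integral_lik_sqrB// -EFinM -EFinD lee_fin.
apply: (@le_trans _ _ (e / 2 + (2 * e)^-1 * e ^+ 2)).
  by rewrite lerD2l ler_wpM2l.
by rewrite le_eqVlt; apply/orP; left; apply/eqP; field; rewrite lt0r_neq0.
Qed.

Hypothesis cvgS : cvgn S.

(** A cylinder only sees finitely many coordinates, so the tilted laws
    eventually give it the probability of the fully shifted law; convergence
    of the densities in the mean makes this the integral of the limit density. *)
Lemma cameron_martin : exists (Q' : probability (RN R) R) (Z' : RN R -> \bar R)
    (phi : nat -> nat),
  [/\ is_product_law (fun i => normal_prob (m i + s ^+ 2 * a i) s) Q',
      measurable_fun setT Z', forall y, (0 <= Z' y)%E,
      {ae Q, forall y, (Z (phi k) y)%:E @[k --> \oo] --> Z' y} &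
      forall B, measurable B -> (Q' B = \int[Q]_(y in B) Z' y)%E].
Proof.
have ndS : nondecreasing_seq S.
  apply/nondecreasing_seqP => n; rewrite /S big_ord_recr/= lerDl sqr_ge0//.
have [||phi [F [phik mF ZF intF]]] := @L1_cauchy_subseq _ _ _ Q Z mZ.
- move=> n; under eq_integral do rewrite ger0_norm ?expR_ge0//.
  by rewrite (integral_lik s0 _ _ Qm) ltry.
- move=> e e0.
  have cE : (expR (S n)) @[n --> \oo] --> expR (limn S).
    exact: (cvg_comp _ _ cvgS (@continuous_expR R _)).
  have /cvgrPdist_le /(_ _ (exprn_gt0 2 e0)) [N _ NP] := cE.
  exists N => n p Nn np; apply: integral_lik_dist => //.
  have := NP _ Nn; rewrite /= => /ler_normlP[_]; apply: le_trans.
  by rewrite lerD2r ler_expR; exact: nondecreasing_cvgn_le.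
have F0 : {ae Q, forall y, (0 <= F y)%E}.
  apply: filterS ZF => y cy.
  have <- := cvg_lim _ cy; last by [].
  apply: lime_ge; first by apply/cvg_ex; exists (F y).
  by apply: nearW => k; rewrite lee_fin expR_ge0.
have mFp : measurable_fun setT F^\+%E by exact: measurable_funepos.
have FE B : measurable B -> (\int[Q]_(y in B) F^\+ y = \int[Q]_(y in B) F y)%E.
  move=> mB; apply: ae_eq_integral => //; try exact: measurable_funTS.
  by apply: filterS F0 => y Fy _; rewrite funeposE; apply/max_idPl.
have int1 : (\int[Q]_y F^\+ y = 1)%E.
  rewrite FE//; have := intF _ measurableT; move=> /cvg_lim <- //.
  under eq_fun do rewrite (integral_lik s0 _ _ Qm).
  by rewrite lim_cst.
have [Q' Q'E] := density_probability mFp (fun y => funepos_ge0 _ _) int1.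
exists Q', F^\+%E, phi; split => //.
  move=> n A mA; rewrite -/(cylinder n A).
  have mC := measurable_cylinder n mA.
  rewrite Q'E// FE//; have := intF _ mC; move=> /cvg_lim <- //.
  apply: lim_near_cst => //; near=> k.
  have nk : (n <= phi k)%N by apply: leq_trans (phik k); near: k; exact: nbhs_infty_ge.
  have [Qk Qkm <-//] := product_law_tilt s0 a (phi k) Qm.
  rewrite Qkm//; apply: eq_bigr => i _.
  by rewrite (leq_trans (ltn_ord i) nk).
have := ZF; apply: filterS2 F0 => y Fy.
suff -> : F^\+%E y = F y by [].
by rewrite funeposE; apply/max_idPl.
Unshelve. all: by end_near. Qed.

End cameron_martin.

(** * Kullback divergence of Gaussian product laws: upper bound *)

Section kullback_density.
Local Open Scope charge_scope.
Context (R : realType) d (T : measurableType d) (P Q : probability T R).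
Variable f : T -> \bar R.
Hypothesis mf : measurable_fun setT f.
Hypothesis f0 : (forall y, 0 <= f y)%E.
Hypothesis QE : (forall A, measurable A -> Q A = \int[P]_(y in A) f y)%E.

Lemma density_integrable : P.-integrable setT f.
Proof.
apply/integrableP; split => //.
under eq_integral do rewrite gee0_abs//.
by rewrite -QE// probability_setT ltry.
Qed.

Lemma density_dominates : Q `<< P.
Proof.
apply/null_content_dominatesP => A mA PA.
by rewrite QE// null_set_integral//; exact: measurable_funTS.
Qed.

Lemma density_ae (C : T -> Prop) : {ae P, forall y, C y} -> {ae Q, forall y, C y}.
Proof.
move=> [N [mN PN sub]]; exists N; split => //.
by have /null_content_dominatesP := density_dominates; exact.
Qed.

Lemma density_gt0_fin : {ae Q, forall y, exists2 r : R, 0 < r & f y = r%:E}.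
Proof.
have fpos : {ae Q, forall y, (0 < f y)%E}.
  have mN : measurable (f @^-1` [set 0%E]).
    by rewrite -[X in measurable X]setTI; exact: mf.
  exists (f @^-1` [set 0%E]); split => //.
    by rewrite QE//; apply: integral0_eq.
  move=> y /= /negP; rewrite -leNgt => fy; apply/le_anti; rewrite fy/=; exact: f0.
have ffin := density_ae (integrable_ae measurableT density_integrable).
apply: filterS2 ffin fpos => y /(_ I).
by case: (f y) => // r _ r0; exists r.
Qed.

(** A density may be used in place of the chosen Radon-Nikodym derivative:
    the two agree almost everywhere. *)
Lemma kullback_density : kullback Q P = (\int[Q]_y lne (f y))%E.
Proof.
rewrite /kullback asboolT; last exact: density_dominates.
have fE : ae_eq P setT ('d (charge_of_finite_measure Q) '/d P) f.
  apply: integral_ae_eq => //; first by apply: Radon_Nikodym_integrable; exact: density_dominates.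
  move=> A _ mA; rewrite -Radon_Nikodym_integral//; last exact: density_dominates.
  exact: QE.
have {}fE := density_ae fE.
by apply/le_anti/andP; split; apply: le_integral_minorant;
  apply: filterS fE => y /(_ I) ->.
Qed.

End kullback_density.

Lemma measurable_fun_limn_einf (R : realType) d (T : measurableType d)
    (f : nat -> T -> \bar R) :
  (forall n, measurable_fun setT (f n)) ->
  measurable_fun setT (fun x => limn_einf (f ^~ x)).
Proof.
move=> mf.
have -> : (fun x => limn_einf (f ^~ x)) = (fun x => - limn_esup (fun n => - f n x))%E.
  apply/funext => x; rewrite -limn_einfN; congr limn_einf.
  by apply/funext => n /=; rewrite oppeK.
apply: measurableT_comp => //; apply: measurable_fun_limn_esup => n.
exact: measurableT_comp.
Qed.

Lemma limn_einf_le (R : realType) (u : (\bar R)^nat) M :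
  (forall n, u n <= M)%E -> (limn_einf u <= M)%E.
Proof.
move=> uM; rewrite limn_einf_lim; apply: lime_le; first exact: is_cvg_einfs.
apply: nearW => n; apply: le_trans (uM n).
by apply: ereal_inf_lbound; exists n => /=.
Qed.

(** As [l] tends to 0, (exp (l (1 + l) L) - 1) / l tends to [L]; the exponent
    is the one that the exponential moment of order [l] of a log-likelihood
    produces. *)
Lemma expR_entropy_small (R : realType) (L e : R) : 0 <= L -> 0 < e ->
  exists2 l : R, 0 < l & expR (l * (1 + l) * L) <= 1 + l * (L + e).
Proof.
move=> L0 e0.
(* Chosen so that [l = e / D] satisfies l <= 1 and l (L + 2 L (L + e)) <= e. *)
pose D := e + L + 2 * L * (L + e) + 1.
have Le : 0 <= L + e by rewrite addr_ge0// ltW.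
have LM : 0 <= L * (L + e) by exact: mulr_ge0.
have D0 : 0 < D by rewrite /D; lra.
pose l := e / D.
have l0 : 0 < l by rewrite divr_gt0.
have lD : l * D = e by rewrite /l divfK// lt0r_neq0.
have l1 : l <= 1 by rewrite ler_pdivrMr// mul1r /D; lra.
exists l => //; set u := l * (1 + l) * L.
(* As exp u <= 1 / (1 - u), this inequality is all that is needed. *)
have key : 1 <= (1 + l * (L + e)) * (1 - u).
  have -> : (1 + l * (L + e)) * (1 - u) =
    1 + l * ((e - l * (L + 2 * L * (L + e))) + l * (1 - l) * L * (L + e)).
    by rewrite /u; ring.
  rewrite lerDl mulr_ge0//; first exact: ltW.
  rewrite addr_ge0//; last first.
    by apply: mulr_ge0 => //; apply: mulr_ge0 => //; rewrite mulr_ge0 ?subr_ge0// ltW.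
  rewrite subr_ge0 -[leRHS]lD ler_wpM2l//; first exact: ltW.
  rewrite /D; lra.
have M0 : 0 < 1 + l * (L + e) by rewrite ltr_wpDr// mulr_ge0 ?(ltW l0).
have u1 : 0 < 1 - u by rewrite -(pmulr_rgt0 _ M0) (lt_le_trans ltr01).
have : expR (- u) >= 1 - u by exact: expR_ge1Dx.
rewrite expRN => h.
have : expR u * (1 - u) <= 1.
  by rewrite -ler_pdivlMl ?expR_gt0// mulr1.
move=> h1; rewrite -(ler_pM2r u1); exact: le_trans h1 key.
Qed.

Section kullback_upper.
Context (R : realType) (s : R) (s0 : s != 0).

(** Under the shifted law, the log-likelihood is again a tilt up to a
    constant; this computes its exponential moments. *)
Lemma loglikZ (m a : nat -> R) (l : R) n y :
  l * loglik s m a n y =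
  loglik s (fun i => m i + s ^+ 2 * a i) (fun i => l * a i) n y +
  l * (1 + l) * (\sum_(i < n) (s * a i) ^+ 2 / 2).
Proof.
rewrite /loglik !mulr_sumr -big_split/=; apply: eq_bigr => i _.
by rewrite /logtilt; field.
Qed.

Context (m a : nat -> R) (Q Q' : probability (RN R) R).
Hypothesis Qm : is_product_law (fun i => normal_prob (m i) s) Q.
Hypothesis Q'm : is_product_law (fun i => normal_prob (m i + s ^+ 2 * a i) s) Q'.
Variable L : R.
Hypothesis SL : (fun n => \sum_(i < n) (s * a i) ^+ 2 / 2) @ \oo --> L.

(** For [l > 0], [l * ln Z] is at most [Z ^ l - 1].  Fatou's lemma under the
    shifted law bounds the integral of [Z ^ l] by the limit
    exp (l (1 + l) L) of the exponential moments of the finite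
    log-likelihoods; then [l] is taken small. *)
Lemma kullback_product_law_le : (kullback Q' Q <= L%:E)%E.
Proof.
have ndS : nondecreasing_seq (fun n => \sum_(i < n) (s * a i) ^+ 2 / 2).
  by apply/nondecreasing_seqP => n; rewrite big_ord_recr/= lerDl divr_ge0// sqr_ge0.
have S_le n : \sum_(i < n) (s * a i) ^+ 2 / 2 <= L.
  rewrite -(cvg_lim _ SL)//; apply: (nondecreasing_cvgn_le ndS).
  by apply/cvg_ex; exists L.
have L0 : 0 <= L by apply: le_trans (S_le 0%N); rewrite big_ord0.
have cvgS : cvgn (fun n => \sum_(i < n) (s * a i) ^+ 2).
  have -> : (fun n => \sum_(i < n) (s * a i) ^+ 2) =
            (fun n => 2 * \sum_(i < n) (s * a i) ^+ 2 / 2).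
    by apply/funext => n; rewrite mulr_sumr; apply: eq_bigr => i _; field.
  by apply: is_cvgM; [exact: is_cvg_cst|apply/cvg_ex; exists L].
have [Q2 [Z [phi [Q2m mZ Z0 ZQ Q2E]]]] := cameron_martin s0 Qm cvgS.
have Q'E B : measurable B -> (Q' B = \int[Q]_(y in B) Z y)%E.
  by move=> mB; rewrite -Q2E//; exact: (product_law_unique Q'm Q2m).
rewrite (kullback_density mZ Q'E); apply/lee_addgt0Pr => e e0.
have [l l0 lE] := expR_entropy_small L0 e0.
pose W k y := (expR (l * loglik s m a (phi k) y))%:E.
pose G y := limn_einf (fun k => W k y).
have mW k : measurable_fun [set: RN R] (W k).
  apply/measurable_EFinP; apply: measurableT_comp => //; apply: measurable_funM => //.
  exact: measurable_loglik.
have mG : measurable_fun [set: RN R] G by exact: measurable_fun_limn_einf.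
have intW k : (\int[Q']_y W k y <= (1 + l * (L + e))%:E)%E.
  rewrite /W; under eq_integral do rewrite loglikZ expRD mulrC EFinM.
  rewrite ge0_integralZl//; last exact: measurable_lik.
  rewrite (integral_lik s0 _ _ Q'm) mule1 lee_fin; apply: le_trans lE.
  by rewrite ler_expR ler_wpM2l// mulr_ge0 ?addr_ge0 ?(ltW l0).
have intG : (\int[Q']_y G y <= (1 + l * (L + e))%:E)%E.
  apply: (le_trans (fatou _ measurableT mW _)).
    by move=> n y _; rewrite lee_fin expR_ge0.
  exact: limn_einf_le.
have G0 y : (0 <= G y)%E.
  rewrite /G limn_einf_lim; apply: lime_ge; first exact: is_cvg_einfs.
  apply: nearW => n; apply: le_ereal_inf_tmp => _ [k _ <-].
  by rewrite lee_fin expR_ge0.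
have iG : Q'.-integrable setT G.
  apply/integrableP; split => //; under eq_integral do rewrite gee0_abs//.
  exact: le_lt_trans intG (ltry _).
have i1 : Q'.-integrable setT (cst 1%E) by exact: finite_measure_integrable_cst.
apply: (@le_trans _ _ (\int[Q']_y (l^-1%:E * (G y - 1)))%E).
  apply: le_integral_minorant.
  have := density_ae mZ Q'E ZQ; apply: filterS2 (density_gt0_fin mZ Z0 Q'E) => y.
  move=> [z z0 Zz]; rewrite Zz => cz.
  rewrite lne_EFin//.
  have {}cz : (expR (loglik s m a (phi k) y)) @[k --> \oo] --> z.
    by move/fine_cvgP : cz => [].
  have cW : W k y @[k --> \oo] --> (expR (l * ln z))%:E.
    apply/fine_cvgP; split; first exact: nearW.
    apply: (cvg_comp (fun k => l * loglik s m a (phi k) y) expR); last exact: continuous_expR.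
    apply: cvgM; first exact: cvg_cst.
    have -> : (fun k => loglik s m a (phi k) y) = @ln R \o (fun k => expR (loglik s m a (phi k) y)).
      by apply/funext => k /=; rewrite expRK.
    by apply: (cvg_comp _ (@ln R) cz); exact: continuous_ln.
  have -> : G y = (expR (l * ln z))%:E.
    by rewrite /G is_cvg_limn_einfE; [exact: cvg_lim|apply/cvg_ex; eexists; exact: cW].
  rewrite -EFinB -EFinM lee_fin ler_pdivlMl//.
  by rewrite lerBrDl expR_ge1Dx.
rewrite integralZl//; last exact: integrableB.
have I1 : (\int[Q']_y (cst 1 y) = 1 :> \bar R)%E.
  by rewrite integral_cst// mul1e; exact: probability_setT.
rewrite integralB// I1.
have Gfin : (\int[Q']_y G y)%E \is a fin_num.
  by rewrite ge0_fin_numE ?integral_ge0// (le_lt_trans intG (ltry _)).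
move: intG; rewrite -(fineK Gfin) lee_fin -EFinB -EFinM -EFinD lee_fin => intG.
by rewrite ler_pdivrMl// lerBlDl.
Qed.

End kullback_upper.

(** * Kullback divergence and means: lower bound *)

Section gibbs.
Context (R : realType) d (T : measurableType d) (P Q : probability T R).
Variable f : T -> \bar R.
Hypothesis mf : measurable_fun setT f.
Hypothesis f0 : (forall y, 0 <= f y)%E.
Hypothesis QE : (forall A, measurable A -> Q A = \int[P]_(y in A) f y)%E.

(** The log-density, with a default value where [f] is 0 or infinite; [Q]
    does not charge that set. *)
Let llr y : R := ln (fine (f y)).

(** exp phi divided by the density. *)
Let w (phi : T -> R) y : R := expR (phi y - llr y).

Let mfine : measurable_fun setT (fun y => fine (f y)).
Proof. exact: (measurableT_comp (@fine_measurable R setT measurableT) mf). Qed.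

Let mllr : measurable_fun setT llr.
Proof. exact: (measurableT_comp (@measurable_ln R) mfine). Qed.

Let mw phi : measurable_fun setT phi -> measurable_fun setT (w phi).
Proof. by move=> mphi; apply: measurableT_comp => //; exact: measurable_funB. Qed.

Let w0 phi y : 0 <= w phi y.
Proof. exact: expR_ge0. Qed.

Let kullbackE : kullback Q P = (\int[Q]_y (llr y)%:E)%E.
Proof.
rewrite (kullback_density mf QE).
have fE := density_gt0_fin mf f0 QE.
by apply/le_anti/andP; split; apply: le_integral_minorant;
  apply: filterS fE => y [r r0 fy]; rewrite /llr fy lne_EFin.
Qed.

Let w_le1 phi : measurable_fun setT phi ->
  (\int[P]_y (expR (phi y))%:E <= 1)%E -> (\int[Q]_y (w phi y)%:E <= 1)%E.
Proof.
move=> mphi phi1.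
rewrite (integral_density (density_integrable mf f0 QE) QE)//; last 2 first.
- by move=> y; rewrite lee_fin.
- by apply/measurable_EFinP; exact: mw.
apply: le_trans phi1; apply: ae_ge0_le_lower_integral => [y|y|].
- by rewrite mule_ge0// lee_fin.
- by rewrite lee_fin expR_ge0.
apply: filterS (integrable_ae measurableT (density_integrable mf f0 QE)) => y /(_ I).
rewrite /w /llr; have := f0 y; case: (f y) => // r; rewrite lee_fin => r0 _ /=.
rewrite -EFinM lee_fin; have [->|rn0] := eqVneq r 0; first by rewrite mulr0 expR_ge0.
have r_gt0 : 0 < r by rewrite lt_neqAle eq_sym rn0.
by rewrite expRD expRN lnK ?posrE// divfK.
Qed.

Let w_integrable phi : measurable_fun setT phi ->
  (\int[P]_y (expR (phi y))%:E <= 1)%E -> Q.-integrable setT (EFin \o w phi).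
Proof.
move=> mphi phi1; apply/integrableP; split.
  by apply/measurable_EFinP; exact: mw.
under eq_integral do rewrite /= ger0_norm//.
exact: le_lt_trans (w_le1 mphi phi1) (ltry _).
Qed.

(** The inequality 1 + t <= exp t, at t = phi - ln f. *)
Let llr_ge phi : {ae Q, forall y, phi y + 1 - w phi y <= llr y}.
Proof.
apply: filterS (density_gt0_fin mf f0 QE) => y _.
rewrite /w; have := expR_ge1Dx (phi y - llr y); lra.
Qed.

(** Half of the Donsker-Varadhan formula, obtained by integrating [llr_ge]. *)
Lemma integral_le_kullback phi : measurable_fun setT phi ->
  (\int[P]_y (expR (phi y))%:E <= 1)%E -> Q.-integrable setT (EFin \o phi) ->
  (\int[Q]_y (phi y)%:E <= kullback Q P)%E.
Proof.
move=> mphi phi1 iphi; rewrite kullbackE.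
have iw := w_integrable mphi phi1.
have i1 : Q.-integrable setT (cst 1%E) by exact: finite_measure_integrable_cst.
apply: (@le_trans _ _ (\int[Q]_y ((phi y)%:E + (1 - (w phi y)%:E)))%E); last first.
  apply: le_integral_minorant; apply: filterS (llr_ge phi) => y.
  by rewrite -EFinB -EFinD lee_fin addrA.
rewrite integralD//; last exact: integrableB.
rewrite leeDl// integralB//.
have I1 : (\int[Q]_y (cst 1 y) = 1 :> \bar R)%E.
  by rewrite integral_cst// mul1e; exact: probability_setT.
by rewrite I1 sube_ge0 ?orbT//; exact: w_le1.
Qed.

(** The case phi = 0 of [llr_ge] shows that the negative part of the
    log-density is always integrable; finiteness of the divergence then
    settles the positive part. *)
Let llr_integrable : (kullback Q P < +oo)%E -> Q.-integrable setT (EFin \o llr).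
Proof.
move=> Kfin.
have mE : measurable_fun setT (EFin \o llr) by exact/measurable_EFinP.
have w01 : (\int[P]_y (expR (cst 0 y : R))%:E <= 1)%E.
  under eq_integral do rewrite expR0.
  by rewrite integral_cst// mul1e probability_le1.
have negfin : (\int[Q]_y ((EFin \o llr)^\- y) < +oo)%E.
  apply: (@le_lt_trans _ _ (\int[Q]_y (w (cst 0) y)%:E)%E); last first.
    exact: le_lt_trans (w_le1 _ w01) (ltry _).
  apply: ae_ge0_le_lower_integral => [y|y|]; [by []|by rewrite lee_fin|].
  apply: filterS (llr_ge (cst 0)) => y; rewrite funenegE ge_max /= => h.
  by rewrite !lee_fin w0 andbT; lra.
have posfin : (\int[Q]_y ((EFin \o llr)^\+ y) < +oo)%E.
  move: Kfin; rewrite kullbackE integralE.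
  move: negfin; have := @integral_ge0 _ _ _ Q setT _ (fun y _ => funeneg_ge0 (EFin \o llr) y).
  case: (\int[Q]_y ((EFin \o llr)^\- y))%E => // r _ _.
  by case: (\int[Q]_y ((EFin \o llr)^\+ y))%E => [q _| |]//; exact: ltry.
apply/integrableP; split => //.
have -> : (\int[Q]_y `|(EFin \o llr) y| = \int[Q]_y ((EFin \o llr)^\+ y + (EFin \o llr)^\- y))%E.
  by apply: eq_integral => y _; rewrite -/((abse \o (EFin \o llr)) y) fune_abse.
rewrite ge0_integralD//; last 2 first.
- exact: measurable_funepos.
- exact: measurable_funeneg.
exact: lte_add_pinfty.
Qed.

(** Exponential moments under [P] and a finite divergence give first moments
    under [Q]. *)
Lemma kullback_integrable (u : T -> R) (c : R) : measurable_fun setT u ->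
  (\int[P]_y (expR (u y - c))%:E <= 1)%E ->
  (\int[P]_y (expR (- u y - c))%:E <= 1)%E ->
  (kullback Q P < +oo)%E -> Q.-integrable setT (EFin \o u).
Proof.
move=> mu up um Kfin.
have mp : measurable_fun setT (fun y => u y - c) by exact: measurable_funB.
have mm : measurable_fun setT (fun y => - u y - c).
  by apply: measurable_funB => //; exact: measurableT_comp.
have iw := w_integrable mp up.
have iw' := w_integrable mm um.
have il := integrable_abse (llr_integrable Kfin).
have ic : Q.-integrable setT (cst `|c|%:E) by exact: finite_measure_integrable_cst.
have ig := integrableD measurableT (integrableD measurableT ic il) (integrableD measurableT iw iw').
apply/integrableP; split; first exact/measurable_EFinP.
move/integrableP : ig => [_]; apply: le_lt_trans.
apply: ae_ge0_le_lower_integral => [y|y|]; [exact: abse_ge0|exact: abse_ge0|].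
apply: filterS2 (llr_ge (fun y => u y - c)) (llr_ge (fun y => - u y - c)) => y h1 h2.
rewrite /= lee_fin [leRHS]ger0_norm ?addr_ge0//.
have := ler_norm c; have := ler_norm (llr y).
have := w0 (fun y => u y - c) y; have := w0 (fun y => - u y - c) y.
by case: (ger0P (u y)) => _; lra.
Qed.

End gibbs.

Section kullback_lower.
Context (R : realType) (s : R) (s0 : s != 0).
Implicit Types (P Q : probability (RN R) R) (m : nat -> R).

(** [fine] sends an infinite mean to 0; the coordinates below are integrable. *)
Definition mean Q (i : nat) : R := fine (\int[Q]_y (coordinate i y)%:E)%E.

Lemma integral_tilt P m i (a : R) :
  is_product_law (fun i => normal_prob (m i) s) P ->
  (\int[P]_y (expR (logtilt s a (m i) (coordinate i y)))%:E = 1)%E.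
Proof.
move=> Pm.
rewrite (product_law_marginal (f := fun t => (expR (logtilt s a (m i) t))%:E) i Pm).
- by rewrite -normal_prob_tilt// probability_setT.
- by apply/measurable_EFinP/measurableT_comp => //; exact: measurable_logtilt.
- by move=> t; rewrite lee_fin expR_ge0.
Qed.

Lemma kullback_dominates P Q : (kullback Q P < +oo)%E -> Q `<< P.
Proof. by rewrite /kullback; case: asboolP => // _; rewrite ltxx. Qed.

Lemma coordinate_integrable P Q m i :
  is_product_law (fun i => normal_prob (m i) s) P ->
  (kullback Q P < +oo)%E ->
  Q.-integrable setT (fun y => (coordinate i y)%:E).
Proof.
move=> Pm Kfin; have QP := kullback_dominates Kfin.
have mc := @measurable_coordinate R i.
have iu : Q.-integrable setT (EFin \o (fun y => coordinate i y - m i)).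
  apply: (kullback_integrable (measurable_int _ (Radon_Nikodym_SigmaFinite.f_integrable QP))
    (Radon_Nikodym_SigmaFinite.f_ge0 QP)
    (Radon_Nikodym_SigmaFinite.f_integral QP) (c := s ^+ 2 / 2)) => //.
  - exact: measurable_funB.
  - rewrite -(integral_tilt i 1 Pm) le_eqVlt; apply/orP; left; apply/eqP.
    by apply: eq_integral => y _; rewrite /logtilt mul1r mulr1.
  - rewrite -(integral_tilt i (-1) Pm) le_eqVlt; apply/orP; left; apply/eqP.
    by apply: eq_integral => y _; rewrite /logtilt mulN1r mulrN1 sqrrN.
have im : Q.-integrable setT (cst (m i)%:E) by exact: finite_measure_integrable_cst.
apply: eq_integrable (integrableD measurableT iu im) => // y _.
by rewrite /= -EFinD subrK.
Qed.

Lemma integral_loglik P Q m a n :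
  is_product_law (fun i => normal_prob (m i) s) P ->
  (kullback Q P < +oo)%E ->
  Q.-integrable setT (EFin \o loglik s m a n) /\
  (\int[Q]_y (loglik s m a n y)%:E =
   (\sum_(i < n) (a i * (mean Q i - m i) - (s * a i) ^+ 2 / 2))%:E)%E.
Proof.
move=> Pm Kfin.
have ic i := coordinate_integrable i Pm Kfin.
have il i : Q.-integrable setT (fun y => (logtilt s (a i) (m i) (coordinate i y))%:E) /\
  (\int[Q]_y (logtilt s (a i) (m i) (coordinate i y))%:E =
   (a i * (mean Q i - m i) - (s * a i) ^+ 2 / 2)%:E)%E.
  pose k : R := - (a i * m i) - (s * a i) ^+ 2 / 2.
  have ik : Q.-integrable setT (cst k%:E) by exact: finite_measure_integrable_cst.
  have ia := integrableZl measurableT (a i) (ic i).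
  have lE y : (logtilt s (a i) (m i) (coordinate i y))%:E =
      ((a i)%:E * (coordinate i y)%:E + k%:E)%E.
    by rewrite -EFinM -EFinD /logtilt /k; congr EFin; ring.
  split; first by apply: eq_integrable (integrableD measurableT ia ik) => // y _; rewrite lE.
  under eq_integral do rewrite lE.
  rewrite integralD// integralZl// integral_cst//.
  rewrite [X in (_ + _ * X)%E](_ : _ = 1%E); last exact: probability_setT.
  rewrite mule1 -(fineK (integrable_fin_num measurableT (ic i))) -EFinM -EFinD.
  by rewrite /mean /k; congr EFin; ring.
split.
  apply: (eq_integrable measurableT (fun y => \sum_(i < n) (logtilt s (a i) (m i) (coordinate i y))%:E)%E).
    by move=> y _; rewrite /= sumEFin.
  by apply: integrable_sum => // i _; case: (il i).
under eq_integral do rewrite -sumEFin.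
rewrite integral_sum//; last by move=> i; case: (il i).
by rewrite -sumEFin; apply: eq_bigr => i _; case: (il i).
Qed.

(** The shift [a] below maximises the bound given by log-likelihoods. *)
Lemma kullback_ge_mean P Q m n :
  is_product_law (fun i => normal_prob (m i) s) P ->
  (kullback Q P < +oo)%E ->
  ((\sum_(i < n) (mean Q i - m i) ^+ 2 / (2 * s ^+ 2))%:E <= kullback Q P)%E.
Proof.
move=> Pm Kfin; have QP := kullback_dominates Kfin.
pose a i := (mean Q i - m i) / s ^+ 2.
have [il lE] := integral_loglik a n Pm Kfin.
have -> : \sum_(i < n) (mean Q i - m i) ^+ 2 / (2 * s ^+ 2) =
  \sum_(i < n) (a i * (mean Q i - m i) - (s * a i) ^+ 2 / 2).
  by apply: eq_bigr => i _; rewrite /a; field.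
rewrite -lE.
apply: (integral_le_kullback (measurable_int _ (Radon_Nikodym_SigmaFinite.f_integrable QP))
    (Radon_Nikodym_SigmaFinite.f_ge0 QP)
    (Radon_Nikodym_SigmaFinite.f_integral QP)) => //.
- exact: measurable_loglik.
- by rewrite (integral_lik s0 _ _ Pm).
Qed.

Lemma kullback_self_le0 Q m :
  is_product_law (fun i => normal_prob (m i) s) Q -> (kullback Q Q <= 0)%E.
Proof.
move=> Qm; apply: (kullback_product_law_le s0 (a := fun=> 0) Qm).
  by under eq_fun do rewrite mulr0 addr0.
under eq_fun do under eq_bigr do rewrite mulr0 expr0n mul0r.
under eq_fun do rewrite big1_eq.
exact: cvg_cst.
Qed.

(** The lower bound, applied to the law itself, whose divergence vanishes,
    forces the mean to be the centre; no Gaussian integral is computed. *)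
Lemma product_law_mean Q m i :
  is_product_law (fun i => normal_prob (m i) s) Q -> mean Q i = m i.
Proof.
move=> Qm; have K0 := kullback_self_le0 Qm.
have := kullback_ge_mean i.+1 Qm (le_lt_trans K0 (ltry _)).
move=> /le_trans/(_ K0); rewrite lee_fin big_ord_recr/= => h.
have S0 : 0 <= \sum_(j < i) (mean Q j - m j) ^+ 2 / (2 * s ^+ 2).
  by apply: sumr_ge0 => j _; rewrite divr_ge0 ?sqr_ge0// mulr_ge0 ?sqr_ge0.
have {h} : (mean Q i - m i) ^+ 2 / (2 * s ^+ 2) <= 0 by rewrite (le_trans _ h)// lerDr.
have s2 : 0 < 2 * s ^+ 2 by rewrite mulr_gt0// exprn_even_gt0.
rewrite ler_pdivrMr// mul0r => h.
have /eqP : (mean Q i - m i) ^+ 2 == 0 by rewrite eq_le h sqr_ge0.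
by move/eqP; rewrite sqrf_eq0 subr_eq0 => /eqP.
Qed.

(** The two bounds meet because the mean of [Q] is [m']. *)
Lemma kullback_product_law P Q m m' L :
  is_product_law (fun i => normal_prob (m i) s) P ->
  is_product_law (fun i => normal_prob (m' i) s) Q ->
  (fun n => \sum_(i < n) (m' i - m i) ^+ 2 / (2 * s ^+ 2)) @ \oo --> L ->
  kullback Q P = L%:E.
Proof.
move=> Pm Qm' SL.
have KL : (kullback Q P <= L%:E)%E.
  pose a i := (m' i - m i) / s ^+ 2.
  apply: (kullback_product_law_le s0 (a := a) Pm).
    have m'E : m' = (fun i => m i + s ^+ 2 * a i).
      by apply/funext => i; rewrite /a; field.
    by have := Qm'; rewrite {1}m'E.
  move: SL; congr (_ @ \oo --> L); apply/funext => n; apply: eq_bigr => i _.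
  by rewrite /a; field.
apply/le_anti; rewrite KL/=.
have Kfin := le_lt_trans KL (ltry _).
have Kge n := kullback_ge_mean n Pm Kfin.
case: (kullback Q P) Kfin Kge => [r| |]// _ Kge; last by have := Kge 0%N.
rewrite lee_fin -(cvg_lim _ SL)//; apply: limr_le; first by apply/cvg_ex; exists L.
apply: nearW => n; rewrite -lee_fin; apply: le_trans (Kge n).
by under eq_bigr do rewrite -(product_law_mean _ Qm').
Qed.

End kullback_lower.

(** * Coordinates in a Hilbert basis *)

Section hilbert.
Context (R : realType) (H : completeNormedModType R).
Context (ip : {dot H for (idfun : R -> R)}) (ip_norm : induces_norm ip).
Context (e : nat -> H) (e_basis : orthonormal_basis ip e).

Lemma ip_sum_basis (c : nat -> R) a b j :
  ip (\sum_(a <= i < b) c i *: e i) (e j) = if (a <= j < b)%N then c j else 0.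
Proof.
have [orth _] := e_basis.
rewrite linear_sumlz/=.
under eq_bigr do rewrite linearZl_LR/= orth.
case: ifPn => jab.
  rewrite (bigD1_seq j) ?mem_index_iota ?iota_uniq//=.
  rewrite eqxx mulr1 big1 ?addr0// => i ij.
  by rewrite (negbTE ij) mulr0.
rewrite big_nat_cond big1// => i /andP[iab _].
by case: eqP => [ij|]; [rewrite -ij iab in jab|rewrite mulr0].
Qed.

Lemma norm_sum_basis (c : nat -> R) a b :
  `|\sum_(a <= i < b) c i *: e i| ^+ 2 = \sum_(a <= i < b) c i ^+ 2.
Proof.
rewrite ip_norm linear_sumr/= big_nat [RHS]big_nat; apply: eq_bigr => i iab.
by rewrite linearZr_LR/= ip_sum_basis iab expr2.
Qed.

Lemma parseval x : (fun n => \sum_(i < n) ip x (e i) ^+ 2) @ \oo --> `|x| ^+ 2.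
Proof.
have [_ /(_ x) cx] := e_basis.
have -> : (fun n => \sum_(i < n) ip x (e i) ^+ 2) =
    (fun n => `|series (fun i => ip x (e i) *: e i) n| ^+ 2).
  by apply/funext => n; rewrite /series/= norm_sum_basis big_mkord.
by rewrite expr2; under eq_fun do rewrite expr2; apply: cvgM; exact: cvg_norm.
Qed.

Lemma bessel x i : ip x (e i) ^+ 2 <= `|x| ^+ 2.
Proof.
rewrite -(cvg_lim _ (@parseval x))//; apply: limr_ge.
  by apply/cvg_ex; exists (`|x| ^+ 2); exact: parseval.
exists i.+1 => // n /= ilt; rewrite (bigD1 (Ordinal ilt))//= lerDl.
by apply: sumr_ge0 => j _; exact: sqr_ge0.
Qed.

(** Orthogonality turns the Cauchy criterion for the series of squares into
    the one for the vector series. *)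
Lemma riesz_fischer (c : nat -> R) : cvgn (series (fun i => c i ^+ 2)) ->
  exists x, forall i, ip x (e i) = c i.
Proof.
move=> cvgc; pose S := series (fun i => c i *: e i).
have cvgS : cvgn S.
  apply/cauchy_cvgP/cauchy_seriesP => r r0.
  have r20 : 0 < r ^+ 2 by exact: exprn_gt0.
  have := cvgc; move/cauchy_cvgP/cauchy_seriesP => /(_ _ r20).
  apply: filterS => -[a b] /=; rewrite -norm_sum_basis ger0_norm ?sqr_ge0//.
  by rewrite ltr_pXn2r ?nnegrE// ltW.
exists (limn S) => j; apply/eqP; rewrite -subr_eq0 -sqrf_eq0.
rewrite eq_le sqr_ge0 andbT.
have c0 : `|limn S - S n| ^+ 2 @[n --> \oo] --> (0 : R).
  rewrite [X in _ --> X](_ : _ = `|limn S - limn S| ^+ 2); last first.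
    by rewrite subrr normr0 expr0n.
  rewrite expr2; under eq_fun do rewrite expr2.
  by apply: cvgM; apply: cvg_norm; apply: cvgB => //; exact: cvg_cst.
rewrite -(cvg_lim _ c0)//; apply: limr_ge; first by apply/cvg_ex; exists 0.
exists j.+1 => // n /= jn; apply: le_trans (bessel _ j).
by rewrite linearBl /= ip_sum_basis /= jn.
Qed.

Lemma cvg_dist_basis x y :
  (fun n => \sum_(i < n) (ip x (e i) - ip y (e i)) ^+ 2) @ \oo --> `|x - y| ^+ 2.
Proof. by under eq_fun do under eq_bigr do rewrite -linearBl; exact: parseval. Qed.

End hilbert.

(** * The two risks *)

Lemma continuous_borel_measurable (R : realType) (H : completeNormedModType R)
    (f : H -> R) :
  continuous f -> measurable_fun [set: borel H] (f : borel H -> measurableTypeR R).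
Proof.
move=> /continuousP cf; apply: (measurability _ (RGenOInfty.measurableE R)) => //.
move=> _ [_ [a ->] <-]; rewrite setTI; apply: sub_sigma_algebra.
by apply: cf; exact: interval_open.
Qed.

Lemma measurable_bigmine (R : realType) d (T : measurableType d) k
    (g : 'I_k -> T -> \bar R) :
  (forall j, measurable_fun setT (g j)) ->
  measurable_fun setT (fun x => \big[mine/+oo%E]_(j < k) g j x).
Proof.
move=> mg; elim: k g mg => [|k ih] g mg.
  by under eq_fun do rewrite big_ord0; exact: measurable_cst.
under eq_fun do rewrite big_ord_recl.
by apply: measurable_mine => //; exact: ih.
Qed.

Lemma bigmine_ge0 (R : realType) k (g : 'I_k -> \bar R) :
  (forall j, 0 <= g j)%E -> (0 <= \big[mine/+oo]_(j < k) g j)%E.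
Proof.
by move=> g0; elim/big_ind : _ => // x y x0 y0; rewrite le_min x0 y0.
Qed.

Lemma le_bigmine (R : realType) k (f g : 'I_k -> \bar R) :
  (forall j, f j <= g j)%E ->
  (\big[mine/+oo]_(j < k) f j <= \big[mine/+oo]_(j < k) g j)%E.
Proof.
move=> fg; elim/big_ind2 : _ => // x1 x2 y1 y2 h1 h2.
by rewrite le_min !ge_min h1 h2 orbT.
Qed.

Lemma bigmine_scale (R : realType) k (g : 'I_k -> R) (r : R) : 0 < r ->
  (r%:E * \big[mine/+oo]_(j < k) (g j)%:E = \big[mine/+oo]_(j < k) (r * g j)%:E)%E.
Proof.
move=> r0; elim/big_ind2 : _ => [|x1 x2 y1 y2 h1 h2|j _]; last by rewrite EFinM.
  by rewrite gt0_muley// lte_fin.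
by rewrite -h1 -h2 mine_pMr// lee_fin ltW.
Qed.

Section assembly.
Context (R : realType) (H : completeNormedModType R).
Context (ip : {dot H for (idfun : R -> R)}) (ip_norm : induces_norm ip).
Context (e : nat -> H) (e_basis : orthonormal_basis ip e).
Context (sigma : R) (sigma_gt0 : 0 < sigma).

Let s0 : sigma != 0. Proof. exact: lt0r_neq0. Qed.
Let s2_gt0 : 0 < 2 * sigma ^+ 2. Proof. by rewrite mulr_gt0// exprn_gt0. Qed.

Let gaussian_law (x : H) (Q : probability (RN R) R) :=
  is_product_law (gaussian_shift ip e sigma x) Q.

Let cvg_dist x y :
  (fun n => \sum_(i < n) (ip x (e i) - ip y (e i)) ^+ 2 / (2 * sigma ^+ 2)) @ \oo -->
  `|x - y| ^+ 2 / (2 * sigma ^+ 2).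
Proof.
under eq_fun do rewrite -mulr_suml.
by apply: cvgM; [exact: cvg_dist_basis|exact: cvg_cst].
Qed.

Lemma kullback_gaussian_shift x c P Q : gaussian_law x P -> gaussian_law c Q ->
  kullback Q P = (`|x - c| ^+ 2 / (2 * sigma ^+ 2))%:E.
Proof.
move=> Px Qc; rewrite distrC.
exact: (@kullback_product_law R sigma s0 P Q (fun i => ip x (e i)) (fun i => ip c (e i)) _ Px Qc (@cvg_dist c x)).
Qed.

(** Infinite products are not constructed from scratch: one Gaussian product
    law reaches all others whose means differ by a vector of [H]. *)
Lemma gaussian_shift_exists x c P : gaussian_law x P -> exists Q, gaussian_law c Q.
Proof.
move=> Px; pose a i := (ip c (e i) - ip x (e i)) / sigma ^+ 2.
have cvga : cvgn (fun n => \sum_(i < n) (sigma * a i) ^+ 2).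
  have -> : (fun n => \sum_(i < n) (sigma * a i) ^+ 2) =
      (fun n => (\sum_(i < n) (ip c (e i) - ip x (e i)) ^+ 2) * (sigma ^+ 2)^-1).
    by apply/funext => n; rewrite mulr_suml; apply: eq_bigr => i _; rewrite /a; field.
  apply: is_cvgM; last exact: is_cvg_cst.
  by apply/cvg_ex; eexists; exact: cvg_dist_basis.
have [Q [_ [_ [Qm _ _ _ _]]]] := @cameron_martin R sigma s0 (fun i => ip x (e i)) a P Px cvga.
exists Q; have cE : (fun i => ip x (e i) + sigma ^+ 2 * a i) = (fun i => ip c (e i)).
  by apply/funext => i; rewrite /a; field.
by rewrite /gaussian_law /gaussian_shift -[X in is_product_law (fun i => normal_prob (X i) _)]cE.
Qed.

(** If one of the divergences is finite, the mean of [mu] is the coordinate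
    sequence of a point of [H], and this point, independent of [x], is the
    codeword; otherwise any point will do. *)
Lemma exists_codeword_le_kullback (mu : probability (RN R) R) : exists c : H,
  forall x P, gaussian_law x P ->
    ((`|x - c| ^+ 2 / (2 * sigma ^+ 2))%:E <= kullback mu P)%E.
Proof.
have [[x0 [P0 [Px0 K0]]]|no] := pselect (exists x P, gaussian_law x P /\ (kullback mu P < +oo)%E);
    last first.
  exists 0 => x P Px; rewrite leNgt; apply/negP => K; apply: no; exists x, P.
  by split => //; exact: lt_trans K (ltry _).
have K0ge n := kullback_ge_mean s0 (m := fun i => ip x0 (e i)) n Px0 K0.
have cvgm : cvgn (series (fun i => (mean mu i - ip x0 (e i)) ^+ 2)).
  apply: nondecreasing_is_cvgn; first by apply: nondecreasing_series => *; exact: sqr_ge0.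
  exists (fine (kullback mu P0) * (2 * sigma ^+ 2)) => _ [n _ <-].
  rewrite -ler_pdivrMr// /series/= mulr_suml big_mkord -lee_fin fineK//.
  by rewrite fin_numElt K0 andbT; apply: (lt_le_trans _ (K0ge 0%N)); exact: ltNyr.
have [z zE] := riesz_fischer ip_norm e_basis cvgm.
(* By construction, the coordinates of [z + x0] are the means of [mu]. *)
exists (z + x0) => x P Px.
have [K|] := ltP (kullback mu P) +oo%E; last by rewrite leye_eq => /eqP ->; rewrite leey.
have Kge n := kullback_ge_mean s0 (m := fun i => ip x (e i)) n Px K.
have Kfin : kullback mu P \is a fin_num.
  by rewrite fin_numElt K andbT; apply: (lt_le_trans _ (Kge 0%N)); exact: ltNyr.
rewrite -(fineK Kfin) lee_fin distrC.
rewrite -(cvg_lim _ (@cvg_dist (z + x0) x))//; apply: limr_le.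
  by apply/cvg_ex; eexists; exact: cvg_dist.
apply: nearW => n; rewrite -lee_fin (fineK Kfin); apply: le_trans (Kge n).
by rewrite lee_fin; under eq_bigr do rewrite linearDl/= zE subrK.
Qed.

Context (PX : probability (borel H) R) (kappa : borel H -> probability (RN R) R).
Hypothesis kappa_gauss : {ae PX, forall x, gaussian_law x (kappa x)}.
Variable k : nat.

Let gcost (c : 'I_k -> H) (x : borel H) : \bar R :=
  \big[mine/+oo%E]_(j < k) (`|(x : H) - c j| ^+ 2 / (2 * sigma ^+ 2))%:E.

Let gcost_ge0 c x : (0 <= gcost c x)%E.
Proof. by apply: bigmine_ge0 => j; rewrite lee_fin divr_ge0 ?sqr_ge0// ltW. Qed.

Let riskE c : risk PX c = ((2 * sigma ^+ 2)%:E * \int[PX]_x gcost c x)%E.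
Proof.
rewrite -ge0_integralZl//; last 2 first.
- apply: measurable_bigmine => j; apply/measurable_EFinP.
  apply: continuous_borel_measurable => x.
  apply: cvgM; last exact: cvg_cst.
  rewrite expr2; under eq_fun do rewrite expr2.
  by apply: cvgM; apply: cvg_norm; apply: cvgB => //; exact: cvg_cst.
- by rewrite lee_fin ltW.
apply: eq_integral => x _; rewrite bigmine_scale//; apply: eq_bigr => j _.
by rewrite mulrC divfK// lt0r_neq0.
Qed.

Lemma risk_kullback_risk (c : 'I_k -> H) :
  risk PX c = kullback_risk sigma PX kappa (gaussian_codebook ip e sigma c).
Proof.
rewrite riskE; congr (_ * _)%E.
apply/esym; apply: ae_eq_ge0_lower_integral => //.
have := kappa_gauss; apply: (@filterS _ _ (ae_filter_ringOfSetsType PX)) => x xg; apply: eq_bigr => j _.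
apply: kullback_gaussian_shift => //.
have [Q Qc] := gaussian_shift_exists (c j) xg.
(* The product law exists, so the default value of [xget] does not occur. *)
exact: (xgetPex point (ex_intro _ Q Qc)).
Qed.

Lemma risk_le_kullback_risk (mu : 'I_k -> probability (RN R) R) :
  exists c : 'I_k -> H, (risk PX c <= kullback_risk sigma PX kappa mu)%E.
Proof.
have [c cP] := choice (fun j => exists_codeword_le_kullback (mu j)).
exists c; rewrite riskE lee_wpmul2l//; first by rewrite lee_fin ltW.
apply: le_integral_minorant; have := kappa_gauss; apply: (@filterS _ _ (ae_filter_ringOfSetsType PX)) => x xg.
by apply: le_bigmine => j; exact: cP.
Qed.

End assembly.

Theorem proposition3 (R : realType) (H : completeNormedModType R)
  (ip : {dot H for (idfun : R -> R)}) (ip_norm : induces_norm ip)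
  (e : nat -> H) (e_basis : orthonormal_basis ip e)
  (sigma : R) (sigma_gt0 : 0 < sigma)
  (d : measure_display) (Omega : measurableType d) (P : probability Omega R)
  (X : {RV P >-> borel H}) (Y : {RV P >-> RN R})
  (PYX : borel H -> probability (RN R) R)
  (PYX_cond : is_conditional_law X Y PYX)
  (PYX_gauss : {ae distribution P X, forall x,
     is_product_law (gaussian_shift ip e sigma x) (PYX x)})
  (k : nat) (k_gt0 : (0 < k)%N) :
  let PX := distribution P X in
  let Rc (c : 'I_k -> H) := risk PX c in
  let Rt (mu : 'I_k -> probability (RN R) R) :=
    kullback_risk sigma PX PYX mu in
  let mu_ (c : 'I_k -> H) := gaussian_codebook ip e sigma c in
  (forall c : 'I_k -> H, Rc c = Rt (mu_ c)) /\
  ereal_inf [set Rc c | c in [set: 'I_k -> H]] =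
    ereal_inf [set Rt (mu_ c) | c in [set: 'I_k -> H]] /\
  ereal_inf [set Rt (mu_ c) | c in [set: 'I_k -> H]] =
    ereal_inf [set Rt mu | mu in [set: 'I_k -> probability (RN R) R]].
Proof.
move=> PX Rc Rt mu_.
have RcRt c : Rc c = Rt (mu_ c).
  exact: (risk_kullback_risk ip_norm e_basis sigma_gt0 PYX_gauss).
split=> //; split.
  by congr ereal_inf; apply/seteqP; split=> _ [c _ <-]; exists c.
apply/le_anti/andP; split.
  apply: le_ereal_inf_tmp => _ [mu _ <-].
  have [c cle] := risk_le_kullback_risk ip_norm e_basis sigma_gt0 PYX_gauss mu.
  apply: ge_ereal_inf; exists (Rt (mu_ c)); first by exists c.
  by rewrite -RcRt.
by apply: ereal_inf_le_tmp => _ [c _ <-]; exists (mu_ c).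
Qed.
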